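(* Let $G$ be a totally disconnected locally compact group, let $\mathfrak{H}$ be a subgroup of $\mathrm{Aut}(G)$ and suppose that $U$ is a compact open subgroup of $G$ which is tidy for $\mathfrak{H}$. Let $\mathfrak{N}_U=\{\alpha\in\mathfrak{H} : \alpha(U)=U\}$. Then $\mathfrak{N}_U$ is normal in $\mathfrak{H}$, and $\mathfrak{H}/\mathfrak{N}_U$ is an abelian, torsion-free group no non-identity element of which is infinitely divisible.
   Context: $\mathrm{Aut}(G)$ is the group of automorphisms of the topological group $G$ (continuous with continuous inverse). A compact open subgroup $V$ of $G$ is tidy for $\alpha\in\mathrm{Aut}(G)$ if $[\alpha(V'):\alpha(V')\cap V']$, as $V'$ ranges over all compact open subgroups of $G$, is minimised at $V'=V$. It is known that $V$ is tidy for $\alpha$ if and only if (T1) $V=V_{\alpha+}V_{\alpha-}$, where $V_{\alpha\pm}=\bigcap_{n\ge 0}\alpha^{\pm n}(V)$, and (T2) $\bigcup_{n\ge 0}\alpha^n(V_{\alpha+})$ is closed. $U$ is tidy for $\mathfrak{H}$ if it is tidy for every $\alpha\in\mathfrak{H}$. An element $x$ of a group is infinitely divisible if there are elements $y_k$ of the group and positive integers $n_k$ with $n_k\to\infty$ as $k\to\infty$ such that $x=y_k^{n_k}$ for every $k$. *)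

(* Defs.v *)
From HB Require Import structures.
From mathcomp Require Import all_boot.
From mathcomp Require Import boolp classical_sets cardinality filter topology.

Set Implicit Arguments.
Unset Strict Implicit.
Unset Printing Implicit Defensive.

Local Open Scope classical_set_scope.
Local Open Scope card_scope.
Local Open Scope group_scope.

Section Subgroups.
Variable T : groupType.
Implicit Types (A B C H N : set T) (x y : T).

Definition is_subgroup A : Prop := group_closed [in A].

Definition is_normal N H : Prop :=
  [/\ is_subgroup N, N `<=` H & forall x y, H x -> N y -> N (y ^ x)].

Definition left_coset x A : set T := [set x * a | a in A].

Definition left_cosets A B : set (set T) := [set left_coset x B | x in A].

Definition set_mulg A B : set T := [set a * b | a in A & b in B].

Definition set_invg A : set T := [set a^-1 | a in A].

Lemma is_subgroupP A :
  is_subgroup A <-> A 1 /\ forall x y, A x -> A y -> A (x / y).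
Proof.
split=> -[A1 AF].
  split=> [|x y Ax Ay]; first by apply/set_mem; exact: A1.
  by apply/set_mem/AF; apply/mem_set.
split; first exact/mem_set.
by move=> x y /set_mem Ax /set_mem Ay; apply/mem_set/AF.
Qed.

Lemma subgroup1 A : is_subgroup A -> A 1.
Proof. by case/is_subgroupP. Qed.

Lemma subgroupV A x : is_subgroup A -> A x -> A x^-1.
Proof. by case/is_subgroupP=> A1 AF Ax; rewrite -[_^-1]mul1g; exact: AF. Qed.

Lemma subgroupM A x y : is_subgroup A -> A x -> A y -> A (x * y).
Proof.
move=> sA Ax Ay; rewrite -[y]invgK; case/is_subgroupP: (sA) => _; apply=> //.
exact: subgroupV.
Qed.

Lemma set_mulgA : associative set_mulg.
Proof.
move=> A B C; apply/seteqP; split=> t [].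
  move=> a Aa [_ [b Bb [c Cc <-]] <-].
  by exists (a * b); [exists a => //; exists b | exists c; rewrite // mulgA].
move=> _ [a Aa [b Bb <-]] [c Cc <-].
by exists a => //; exists (b * c); [exists b => //; exists c | rewrite mulgA].
Qed.

Lemma left_coset1 A : left_coset 1 A = A.
Proof.
apply/seteqP; split=> [_ [a Aa <-]|a Aa]; first by rewrite mul1g.
by exists a; rewrite ?mul1g.
Qed.

Section Normal.
Variables (N H : set T).
Hypothesis nN : is_normal N H.

Lemma left_cosetM x y : H y ->
  set_mulg (left_coset x N) (left_coset y N) = left_coset (x * y) N.
Proof.
case: nN => sN _ nNJ Hy; apply/seteqP; split=> [t [_ [a Na <-]]|_ [a Na <-]].
  move=> [_ [b Nb <-] <-]; exists (a ^ y * b).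
    by apply: subgroupM => //; exact: nNJ.
  by rewrite mulgA -[x * y * _]mulgA -conjgC !mulgA.
exists x; first by exists 1; [exact: subgroup1 | rewrite mulg1].
by exists (y * a); [exists a | rewrite mulgA].
Qed.

Lemma left_cosetV x : is_subgroup H -> H x ->
  set_invg (left_coset x N) = left_coset x^-1 N.
Proof.
case: nN => sN _ nNJ sH Hx; apply/seteqP; split.
  move=> _ [_ [a Na <-] <-]; exists (a^-1 ^ x^-1).
    by apply: nNJ; exact: subgroupV.
  by rewrite -conjgC invgM.
move=> _ [a Na <-]; exists (x * (a^-1 ^ x)).
  by exists (a^-1 ^ x) => //; apply: nNJ => //; exact: subgroupV.
by rewrite -conjgC invgM invgK.
Qed.

End Normal.

(* The group H / N: its elements are the cosets of N by elements of H,
   multiplied and inverted setwise. *)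
Definition quotient N H (sH : is_subgroup H) (nN : is_normal N H) : Type :=
  set_type (left_cosets H N).

Section Quotient.
Variables (N H : set T) (sH : is_subgroup H) (nN : is_normal N H).

HB.instance Definition _ :=
  Choice.copy (quotient sH nN) (set_type (left_cosets H N)).

Fact quotient_one_subproof : N \in left_cosets H N.
Proof.
by apply/mem_set; exists 1; [exact: subgroup1 | rewrite left_coset1].
Qed.

Fact quotient_mul_subproof (C D : quotient sH nN) :
  set_mulg (val C) (val D) \in left_cosets H N.
Proof.
apply/mem_set; case/set_mem: (valP C) (valP D) => x Hx <- /set_mem[y Hy <-].
by exists (x * y); [exact: subgroupM | rewrite (left_cosetM nN)].
Qed.

Fact quotient_inv_subproof (C : quotient sH nN) :
  set_invg (val C) \in left_cosets H N.
Proof.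
apply/mem_set; case/set_mem: (valP C) => x Hx <-.
by exists x^-1; [exact: subgroupV | rewrite (left_cosetV nN)].
Qed.

Definition quotient_one : quotient sH nN :=
  exist (fun C => C \in left_cosets H N) _ quotient_one_subproof.
Definition quotient_mul (C D : quotient sH nN) : quotient sH nN :=
  exist (fun E => E \in left_cosets H N) _ (quotient_mul_subproof C D).
Definition quotient_inv (C : quotient sH nN) : quotient sH nN :=
  exist (fun E => E \in left_cosets H N) _ (quotient_inv_subproof C).

Fact quotient_mulA : associative quotient_mul.
Proof. by move=> C D E; apply: val_inj; rewrite /= set_mulgA. Qed.

Fact quotient_mul1 : left_id quotient_one quotient_mul.
Proof.
move=> C; apply: val_inj => /=; case/set_mem: (valP C) => x Hx <-.
by rewrite -{1}(left_coset1 N) (left_cosetM nN) // mul1g.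
Qed.

Fact quotient_mulr1 : right_id quotient_one quotient_mul.
Proof.
move=> C; apply: val_inj => /=; case/set_mem: (valP C) => x Hx <-.
rewrite -{2}(left_coset1 N) (left_cosetM nN) ?mulg1 //; exact: subgroup1.
Qed.

Fact quotient_mulV : left_inverse quotient_one quotient_inv quotient_mul.
Proof.
move=> C; apply: val_inj => /=; case/set_mem: (valP C) => x Hx <-.
by rewrite (left_cosetV nN) // (left_cosetM nN) // mulVg left_coset1.
Qed.

Fact quotient_mulrV : right_inverse quotient_one quotient_inv quotient_mul.
Proof.
move=> C; apply: val_inj => /=; case/set_mem: (valP C) => x Hx <-.
rewrite (left_cosetV nN) // (left_cosetM nN) ?mulgV ?left_coset1 //.
exact: subgroupV.
Qed.

HB.instance Definition _ := isGroup.Build (quotient sH nN)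
  quotient_mulA quotient_mul1 quotient_mulr1 quotient_mulV quotient_mulrV.

End Quotient.

Definition abelian_group : Prop := forall x y, commute x y.

Definition torsion_free : Prop :=
  forall x n, (0 < n)%N -> x ^+ n = 1 -> x = 1.

Definition infinitely_divisible x : Prop :=
  exists (y : nat -> T) (n : nat -> nat),
    [/\ forall k, (0 < n k)%N, n k @[k --> \oo] --> \oo
      & forall k, x = y k ^+ n k].

End Subgroups.

HB.mixin Record isTopologicalGroup G of Topological G & Group G := {
  mulg_continuous : continuous (fun xy : G * G => xy.1 * xy.2 : G) ;
  invg_continuous : continuous (fun x : G => x^-1 : G)
}.

#[short(type="topologicalGroupType")]
HB.structure Definition TopologicalGroup :=
  {G of Topological G & Group G & isTopologicalGroup G}.

Section Automorphisms.
Variable G : topologicalGroupType.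
Implicit Types (f : G -> G) (U V : set G).

Definition is_topaut : set (G -> G) := [set f |
  [/\ {morph f : x y / x * y}, continuous f
    & exists g, [/\ cancel f g, cancel g f & continuous g]]].

Definition topaut : Type := set_type is_topaut.

HB.instance Definition _ := Choice.copy topaut (set_type is_topaut).

Definition topaut_fun (a : topaut) : G -> G := val a.
Coercion topaut_fun : topaut >-> Funclass.

Lemma topautP (a : topaut) : is_topaut a.
Proof. exact: set_mem (valP a). Qed.

Lemma topaut_eq (a b : topaut) : a =1 b -> a = b.
Proof. by move=> /funext ab; apply: val_inj. Qed.

Fact topaut_one_subproof : id \in is_topaut.
Proof.
apply/mem_set; split=> //; first by move=> x; exact: cvg_id.
by exists id; split=> // x; exact: cvg_id.
Qed.

Fact topaut_mul_subproof (a b : topaut) : a \o b \in is_topaut.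
Proof.
apply/mem_set; have [aM ac [a' [aK a'K a'c]]] := topautP a.
have [bM bc [b' [bK b'K b'c]]] := topautP b.
split; first by move=> x y /=; rewrite bM aM.
  by move=> x; apply: continuous_comp; [exact: bc | exact: ac].
exists (b' \o a'); split; [exact: can_comp | exact: can_comp |].
by move=> x; apply: continuous_comp; [exact: a'c | exact: b'c].
Qed.

Fact topaut_inv_exists (a : topaut) : exists g : G -> G,
  [/\ cancel a g, cancel g a & g \in is_topaut].
Proof.
have [aM ac [g [aK gK gc]]] := topautP a.
exists g; split=> //; apply/mem_set; split=> //; last by exists a.
by move=> x y; rewrite -{1}(gK x) -{1}(gK y) -aM aK.
Qed.

Definition topaut_inv_fun (a : topaut) := projT1 (cid (topaut_inv_exists a)).

Fact topaut_inv_funP (a : topaut) :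
  [/\ cancel a (topaut_inv_fun a), cancel (topaut_inv_fun a) a
    & topaut_inv_fun a \in is_topaut].
Proof. exact: projT2 (cid (topaut_inv_exists a)). Qed.

Fact topaut_inv_subproof (a : topaut) : topaut_inv_fun a \in is_topaut.
Proof. by case: (topaut_inv_funP a). Qed.

Definition topaut_one : topaut :=
  exist (fun f => f \in is_topaut) _ topaut_one_subproof.
Definition topaut_mul (a b : topaut) : topaut :=
  exist (fun f => f \in is_topaut) _ (topaut_mul_subproof a b).
Definition topaut_inv (a : topaut) : topaut :=
  exist (fun f => f \in is_topaut) _ (topaut_inv_subproof a).

Fact topaut_mulA : associative topaut_mul.
Proof. by move=> a b c; apply: topaut_eq. Qed.

Fact topaut_mul1 : left_id topaut_one topaut_mul.
Proof. by move=> a; apply: topaut_eq. Qed.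

Fact topaut_mulr1 : right_id topaut_one topaut_mul.
Proof. by move=> a; apply: topaut_eq. Qed.

Fact topaut_mulV : left_inverse topaut_one topaut_inv topaut_mul.
Proof. by move=> a; apply: topaut_eq; case: (topaut_inv_funP a). Qed.

Fact topaut_mulrV : right_inverse topaut_one topaut_inv topaut_mul.
Proof. by move=> a; apply: topaut_eq; case: (topaut_inv_funP a). Qed.

HB.instance Definition _ := isGroup.Build topaut
  topaut_mulA topaut_mul1 topaut_mulr1 topaut_mulV topaut_mulrV.

Definition compact_open_subgroup V : Prop :=
  [/\ is_subgroup V, compact V & open V].

(* Indices are compared as the cardinalities of the corresponding sets of
   left cosets. *)
Definition displacement_cosets (a : topaut) V : set (set G) :=
  left_cosets (a @` V) (a @` V `&` V).

Definition tidy (a : topaut) V : Prop :=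
  compact_open_subgroup V /\
  forall W, compact_open_subgroup W ->
    displacement_cosets a V #<= displacement_cosets a W.

Definition tidy_for (H : set topaut) V : Prop :=
  forall a, H a -> tidy a V.

Definition set_stabilizer (H : set topaut) U : set topaut :=
  [set a | H a /\ a @` U = U].

End Automorphisms.

(* Main.v *)
Require Import Defs.
From HB Require Import structures.
From mathcomp Require Import all_boot zify finmap.
From mathcomp Require Import boolp classical_sets cardinality filter topology.

Set Implicit Arguments.
Unset Strict Implicit.
Unset Printing Implicit Defensive.

Local Open Scope classical_set_scope.
Local Open Scope group_scope.

(** Let s(a) be the index of [a(U) `&` U] in a(U). An automorphism stabilises
    U exactly when s(a) = s(a^-1) = 1, so the quotient of H by the stabiliser
    can be studied through s, which is constant on its cosets and
    submultiplicative. The theorem follows from one more property,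
    homogeneity: s(a^n) = s(a)^n for a in H.

    Indeed log s then induces a homogeneous length function on the quotient,
    positive at x or at x^-1 unless x = 1. Homogeneity kills it on torsion
    elements. Since s takes integer values, x = y^n with 2^n > s(x) forces
    s(y) = 1, hence s(x) = 1, and likewise for x^-1, so no nontrivial element
    is infinitely divisible. Finally, as in the theorem of the Polymath
    project on homogeneous length functions, it vanishes on commutators
    ([hom_length_commutator]), so the quotient is abelian.

    Homogeneity ([index_image_exp]): submultiplicativity gives
    s(a^n) <= s(a)^n. For the converse it is enough to find C with
    s(a)^m <= C s(a^m) for all m ([scale_growth]), for this applied to n m
    gives s(a)^(n m) <= C s(a^n)^m for all m. If S is a compact open subgroup,
    the index in a^m(S) of the intersection of S, a(S), ..., a^m(S) is a product
    of m displacement indices, hence is at least s(a)^m because U is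
    minimising. What has to be excluded is that this intersection is much
    smaller than [a^m(S) `&` S], which happens if points leave S and return.
    Let L be the group of points whose orbit lies in U at all but finitely
    many times. It meets finitely many cosets of U
    ([homoclinic_finite_index]), so L U is a compact open set and its
    stabiliser S under left translation is a compact open subgroup containing
    L ([compact_open_envelope]). If O is a compact open subgroup of [U `&` S]
    with least displacement, then O factors into a part that stays in O under
    all a^-i and a part that stays in O under all a^i
    ([factor_of_minimal]). By this factorisation, a point of [a^m(O) `&` O] is
    a product of an element of L and of points which have not left S; as S
    contains L, the point itself lies in S, a(S), ..., a^m(S). *)

(** * Homogeneous length functions *)

(** A constant factor is invisible to arbitrarily large powers: this is how
    homogeneity turns coarse estimates into sharp ones below. *)
Lemma leq_of_expn_leq a b C :
  (forall N, exists2 n, (N <= n)%N & (a ^ n <= C * b ^ n)%N) -> (a <= b)%N.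
Proof.
move=> H; rewrite leqNgt; apply/negP => ba.
have [n Nn] := H (C * b).+1.
have growth : ((b + n) * b ^ n <= b * b.+1 ^ n)%N.
  elim: {Nn} n => [|n IH]; first by rewrite addn0 !expn0.
  rewrite expnS [X in (_ <= _ * X)%N]expnS.
  set u := (b ^ n)%N in IH *; set v := (b.+1 ^ n)%N in IH *; nia.
have le_ab : (b.+1 ^ n <= a ^ n)%N by rewrite leq_exp2r //; lia.
move=> aC; have : (b ^ n <> 0)%N.
  move=> b0; move: aC; rewrite b0 muln0 leqn0 expn_eq0; lia.
set u := (b ^ n)%N in growth aC *; set v := (b.+1 ^ n)%N in growth le_ab.
set w := (a ^ n)%N in aC le_ab.
nia.
Qed.

Lemma leq_expn2r n a b : (a <= b)%N -> (a ^ n <= b ^ n)%N.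
Proof. by case: n => // n ab; rewrite leq_exp2r. Qed.

Section HomogeneousLength.
Variables (T : groupType) (s : T -> nat).
Hypothesis sM : forall x y, (s (x * y) <= s x * s y)%N.
Hypothesis sX : forall x n, s (x ^+ n) = (s x ^ n)%N.
Implicit Types x y z w t : T.

Let s1 : s 1 = 1%N.
Proof. by rewrite -(expg0 1) sX. Qed.

Lemma hom_length_gt0 x : (0 < s x)%N.
Proof. by have := sM x x^-1; rewrite mulgV s1 muln_gt0 => /andP[]. Qed.

(** The powers of a conjugate are conjugate by a fixed element, whose length
    is a bounded factor. *)
Lemma hom_lengthJ x t : s (x ^ t) = s x.
Proof.
suff le y u : (s (y ^ u) <= s y)%N.
  by apply/eqP; rewrite eqn_leq le /= -{1}(conjgK t x).
apply: (@leq_of_expn_leq _ _ (s u^-1 * s u)) => N; exists N => //.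
rewrite -!sX -conjXg conjgE mulnAC -mulnA.
by apply: leq_trans (sM _ _) _; rewrite leq_mul2l sM orbT.
Qed.

(** Write x^2N as (w y)^N t^-1 (z w^-1)^N t. The factors w and w^-1 at the two
    ends of the product of the first three factors can be removed by a
    conjugation, one pair after the other, so that only t contributes besides
    N copies of y and of z. *)
Lemma hom_length_split x w y z t :
  x = w * y -> x = (z * w^-1) ^ t -> (s x ^ 2 <= s y * s z)%N.
Proof.
move=> xE xE'; apply: (@leq_of_expn_leq _ _ (s t^-1 * s t)) => N.
exists N => //.
have cancel_ends : (s ((w * y) ^+ N * t^-1 * (z * w^-1) ^+ N)
    <= s t^-1 * (s y * s z) ^ N)%N.
  elim: N => [|N IH]; first by rewrite !expg0 mul1g mulg1 expn0 muln1.
  rewrite [in X in (X <= _)%N]expgS expgSr.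
  set r := _ * t^-1 * _ in IH.
  have -> : w * y * (w * y) ^+ N * t^-1 * ((z * w^-1) ^+ N * (z * w^-1)) =
      (y * r * z) ^ w^-1 by rewrite conjgE invgK /r !mulgA.
  (* The outermost factors w and w^-1 amount to a conjugation. *)
  rewrite hom_lengthJ expnS; have le1 := sM (y * r) z; have le2 := sM y r.
  move: IH; set K := (_ ^ N)%N => IH.
  have : (s y * s r * s z <= s y * (s t^-1 * K) * s z)%N.
    by rewrite leq_mul2r leq_mul2l IH !orbT.
  have : (s (y * r) * s z <= s y * s r * s z)%N by rewrite leq_mul2r le2 orbT.
  lia.
rewrite mulnAC -expnM -sX mul2n -addnn expgnDr.
have -> : x ^+ N * x ^+ N = (w * y) ^+ N * t^-1 * (z * w^-1) ^+ N * t.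
  by rewrite {1}xE xE' -conjXg conjgE !mulgA.
by apply: leq_trans (sM _ _) _; rewrite leq_mul2r cancel_ends orbT.
Qed.

Section Commutator.
Variables x y : T.
Let c := x * y * x^-1 * y^-1.
Let F i j k := s (x ^+ i * x^-1 ^+ j * c ^+ k).

(** The exponents of x and c perform a random walk: x^(i-j) c^(k+1) is both x
    times x^(i-j-1) c^(k+1) and a conjugate of z x^-1, where z is conjugate to
    x^(i-j+1) c^k. The exponent of x has no drift while that of c decreases.
    It is written i - j so as to keep all exponents natural. *)
Lemma commutator_walk i j k :
  (F i j k.+1 ^ 2 <= F i j.+1 k.+1 * F i.+1 j k)%N.
Proof.
set w := x ^+ i * x^-1 ^+ j * c ^+ k.
have -> : F i.+1 j k = s (y^-1 * w * (x * y)).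
  have -> : y^-1 * w * (x * y) = (x * w) ^ (x * y).
    by rewrite conjgM !conjgE !mulgA mulgVK.
  by rewrite hom_lengthJ /F /w expgS !mulgA.
apply: (@hom_length_split _ x _ _ (y^-1)).
  by rewrite !mulgA -expgS (expgSr x i) (expgS x^-1 j) mulgA mulgK.
by rewrite conjgE invgK expgSr /c !mulgA mulgV mul1g.
Qed.

Let dist i j := ((i - j) + (j - i))%N.

(** The function m^2 + 2 k is harmonic for the walk (m, k) -> (m - 1, k) or
    (m + 1, k - 1), with equal probabilities, and n |m| <= m^2 + n^2 compares it
    with the length of x^m on the boundary k = 0. A minimum principle then
    propagates the bound, (m^2 + 2 k + n^2) / n times log P, to all k. *)
Lemma commutator_bound P n i j k : (s x <= P)%N -> (s x^-1 <= P)%N ->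
  (F i j k ^ n <= P ^ (dist i j ^ 2 + 2 * k + n ^ 2))%N.
Proof.
move=> xP x'P; have P_gt0 : (0 < P)%N.
  by apply: leq_trans xP; exact: hom_length_gt0.
have F0 u v : (F u v 0 <= P ^ dist u v)%N.
  rewrite /F expg0 mulg1; have [uv|/ltnW vu] := leqP u v.
    rewrite -(subnKC uv) expgnDr mulgA [x^-1 ^+ u]expVgn mulgV mul1g sX.
    have -> : dist u (u + (v - u)) = (v - u)%N by rewrite /dist; lia.
    exact: leq_expn2r.
  rewrite -(subnK vu) expgnDr expVgn mulgK sX.
  have -> : dist (u - v + v) v = (u - v)%N by rewrite /dist; lia.
  exact: leq_expn2r.
pose E u v l := (dist u v ^ 2 + 2 * l + n ^ 2)%N.
rewrite -/(E i j k); elim: k i j => [|k IHk] i j.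
  apply: (@leq_trans ((P ^ dist i j) ^ n)); first exact: leq_expn2r.
  rewrite -expnM leq_pexp2l // /E; nia.
pose C := (s c ^ (k.+1 * n))%N.
(* The factor C comes from bounding the power of c by submultiplicativity
   alone. Its weight, relative to the exponents, is halved at each step of the
   walk: half of the mass moves to the exponent k of c, where the harmonic
   bound holds without loss. *)
have step (t u v : nat) :
    (F u v k.+1 ^ (n * 2 ^ t) <= C * P ^ (2 ^ t * E u v k.+1))%N.
  elim: t u v => [|t IHt] u v.
    rewrite expn0 muln1 mul1n.
    have : (F u v k.+1 <= P ^ dist u v * s c ^ k.+1)%N.
      apply: leq_trans (sM _ _) _; rewrite -sX leq_mul2r.
      by move: (F0 u v); rewrite /F expg0 mulg1 => ->; rewrite orbT.
    move/(leq_expn2r n)/leq_trans; apply.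
    rewrite expnMn -!expnM mulnC leq_mul2l; apply/orP; right.
    rewrite leq_pexp2l // /E; nia.
  have -> : (n * 2 ^ t.+1 = 2 * (n * 2 ^ t))%N by rewrite expnS; lia.
  rewrite expnM; apply: leq_trans (leq_expn2r _ (commutator_walk u v k)) _.
  rewrite expnMn.
  apply: leq_trans
    (leq_mul (IHt _ _) (_ : _ <= P ^ (2 ^ t * E u.+1 v k))%N) _.
    by rewrite expnM [X in (_ <= _ ^ X)%N]mulnC expnM leq_expn2r // IHk.
  rewrite -mulnA -expnD leq_mul2l; apply/orP; right.
  rewrite leq_pexp2l // -mulnDr expnS -mulnA mulnCA leq_mul2l; apply/orP; right.
  rewrite /E /dist; nia.
apply: (@leq_of_expn_leq _ _ C) => t; exists (2 ^ t)%N.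
  by apply: ltnW; apply: ltn_expl.
by rewrite -!expnM [(E _ _ _ * _)%N]mulnC; exact: step.
Qed.
End Commutator.

(** A driftless walk goes a distance of order n in n^2 steps, so log s(c^(n^2))
    is at most of order n; by homogeneity it is n^2 log s(c), whence
    log s(c) = 0. *)
Lemma hom_length_commutator x y : s (x * y * x^-1 * y^-1) = 1%N.
Proof.
set c := _ * y^-1; pose P := (s x * s x^-1)%N.
have xP : (s x <= P)%N.
  by rewrite /P -{1}(muln1 (s x)) leq_mul2l hom_length_gt0 orbT.
have x'P : (s x^-1 <= P)%N.
  by rewrite /P -{1}(mul1n (s x^-1)) leq_mul2r hom_length_gt0 orbT.
have P_gt0 : (0 < P)%N by rewrite muln_gt0 !hom_length_gt0.
have cP n : (s c ^ n <= P ^ 3)%N.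
  have [->|n_gt0] := posnP n; first by rewrite expn0 expn_gt0 P_gt0.
  rewrite -(@leq_exp2r _ _ (n ^ 2)) ?expn_gt0 ?n_gt0 // -!expnM.
  have := @commutator_bound x y P n 0 0 (n ^ 2) xP x'P.
  rewrite !expg0 !mul1g sX -/c -expnM [(n * _)%N]mulnC => /leq_trans; apply.
  by rewrite leq_pexp2l //; lia.
apply/eqP; rewrite eqn_leq hom_length_gt0 andbT.
apply: (@leq_of_expn_leq _ _ (P ^ 3)) => n; exists n => //.
by rewrite exp1n muln1.
Qed.
End HomogeneousLength.

(** * Groups with a homogeneous integral length *)
Section DiscreteLength.
Variables (T : groupType) (s : T -> nat).
Hypothesis sM : forall x y, (s (x * y) <= s x * s y)%N.
Hypothesis sX : forall x n, s (x ^+ n) = (s x ^ n)%N.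
Hypothesis s_eq1 : forall x, s x = 1%N -> s x^-1 = 1%N -> x = 1.

Lemma hom_length_abelian : abelian_group T.
Proof.
move=> x y; apply: (@mulIg _ x^-1); apply: (@mulIg _ y^-1).
rewrite mulgK mulgV; apply: s_eq1; first exact: hom_length_commutator.
have -> : (x * y * x^-1 * y^-1)^-1 = y * x * y^-1 * x^-1.
  by rewrite !invgM !invgK !mulgA.
exact: hom_length_commutator.
Qed.

Lemma hom_length_torsion_free : torsion_free T.
Proof.
move=> x n n_gt0 xn1.
have root1 y : y ^+ n = 1 -> s y = 1%N.
  move=> yn1; apply/eqP; rewrite -(eqn_exp2r _ _ n_gt0) -sX yn1 exp1n.
  by rewrite -(expg0 1) sX.
by apply: s_eq1; apply: root1; rewrite ?expVgn xn1 ?invg1.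
Qed.

Lemma hom_length_not_infinitely_divisible (x : T) :
  x <> 1 -> ~ infinitely_divisible x.
Proof.
move=> x1 [y [n [_ noo xE]]]; apply: x1.
have one z w : (forall k, z = w k ^+ n k) -> s z = 1%N.
  move=> zE.
  have [k sk] : exists k, (s z < n k)%N.
    have [K _ HK] := noo _ (nbhs_infty_gt (s z)).
    by exists K; apply: HK => /=.
  have : (s (w k) ^ n k < 2 ^ n k)%N.
    by rewrite -sX -zE (ltn_trans sk) // ltn_expl.
  rewrite ltn_exp2r; last by lia.
  have := hom_length_gt0 sM sX (w k); rewrite (zE k) sX.
  by case: (s (w k)) => [|[|]] // _ _; rewrite exp1n.
by apply: s_eq1; [exact: one xE | apply: (one _ (fun k => (y k)^-1)) => k;
  rewrite expVgn -xE].
Qed.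
End DiscreteLength.

(** * Counting cosets *)

Section Index.
Variable T : groupType.
Implicit Types (A B C : set T) (x y : T) (r : seq T).

Lemma left_coset_eqP B x y : is_subgroup B ->
  left_coset x B = left_coset y B <-> B (x^-1 * y).
Proof.
move=> sB; split=> [xyE|Bxy].
  have : left_coset x B y.
    by rewrite xyE; exists 1; rewrite ?mulg1//; exact: subgroup1.
  by case=> b Bb <-; rewrite mulKg.
apply/seteqP; split=> [_ [b Bb <-]|_ [b Bb <-]].
  exists ((x^-1 * y)^-1 * b).
    by apply: (subgroupM sB) => //; exact: subgroupV.
  by rewrite invgM invgK !mulgA mulgV mul1g.
by exists (x^-1 * y * b); [exact: subgroupM | rewrite !mulgA mulgV mul1g].
Qed.

Definition finite_index A B : Prop := finite_set (left_cosets A B).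

(** As A need not contain B, this is the index of [A `&` B] in A when both are
    groups; counting cosets of B instead of [A `&` B] makes comparisons for
    different A immediate. *)
Definition coset_index A B : nat := #|` fset_set (left_cosets A B)|.

Definition coset_cover A B r : Prop :=
  forall a, A a -> exists2 x, x \in r & B (x^-1 * a).

Definition distinct_cosets B r : Prop :=
  uniq r /\ {in r &, forall x y, B (x^-1 * y) -> x = y}.

Lemma covers_finite_index A B r : is_subgroup B -> coset_cover A B r ->
  finite_index A B /\ (coset_index A B <= size r)%N.
Proof.
move=> sB cov; pose s := [seq left_coset x B | x <- r].
have As X : left_cosets A B X -> X \in s.
  move=> [a Aa <-]; have [x xr Bxa] := cov a Aa.
  by apply/mapP; exists x => //; apply/esym/left_coset_eqP.
have fA : finite_index A B by exact: sub_finite_set As (finite_seq s).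
split=> //; rewrite -(size_map (fun x => left_coset x B)) -/s.
apply: uniq_leq_size => // X; rewrite in_fset_set // inE; exact: As.
Qed.

Lemma distinct_leq_index A B r : is_subgroup B -> finite_index A B ->
  (forall x, x \in r -> A x) -> distinct_cosets B r ->
  (size r <= coset_index A B)%N.
Proof.
move=> sB fA rA [ur sep]; pose s := [seq left_coset x B | x <- r].
rewrite -(size_map (fun x => left_coset x B)) -/s.
apply: uniq_leq_size.
  rewrite map_inj_in_uniq // => x y xr yr /(left_coset_eqP _ _ sB).
  exact: sep.
move=> _ /mapP[x xr ->]; rewrite in_fset_set // inE.
by exists x => //; exact: rA.
Qed.

Lemma index_transversal A B : is_subgroup B -> finite_index A B ->
  exists r, [/\ forall x, x \in r -> A x, coset_cover A B r, distinct_cosets B r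
     & size r = coset_index A B].
Proof.
move=> sB fA.
pose rep (X : set T) := xget 1 [set x | A x /\ left_coset x B = X].
have repP X : X \in fset_set (left_cosets A B) ->
    A (rep X) /\ left_coset (rep X) B = X.
  rewrite in_fset_set // inE => -[a Aa aX].
  exact: (@xgetPex _ 1 [set x | A x /\ left_coset x B = X])
    (ex_intro _ a (conj Aa aX)).
have rep_inj : {in fset_set (left_cosets A B) &, injective rep}.
  by move=> X Y /repP[_ {2}<-] /repP[_ {2}<-] ->.
exists (map rep (fset_set (left_cosets A B))); split.
- by move=> _ /mapP[X /repP[AX _] ->].
- move=> a Aa; pose X := left_coset a B.
  have X_in : X \in fset_set (left_cosets A B).
    by rewrite in_fset_set // inE; exists a.
  exists (rep X); first exact: map_f.
  by apply/left_coset_eqP => //; have [] := repP X X_in.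
- split; first by rewrite map_inj_in_uniq // fset_uniq.
  move=> _ _ /mapP[X Xin ->] /mapP[Y Yin ->] /(left_coset_eqP _ _ sB).
  by have [_ ->] := repP X Xin; have [_ ->] := repP Y Yin => ->.
- by rewrite size_map.
Qed.

(** The inclusion of B' in B is only required for quotients of elements of A,
    so that a subgroup can be replaced by its intersection with a group A. *)
Lemma index_le A B A' B' : is_subgroup B -> is_subgroup B' ->
  finite_index A' B' -> A `<=` A' ->
  (forall x y, A x -> A y -> B' (x^-1 * y) -> B (x^-1 * y)) ->
  finite_index A B /\ (coset_index A B <= coset_index A' B')%N.
Proof.
move=> sB sB' fA' AA' B'B; have [r [_ cov _ <-]] := index_transversal sB' fA'.
pose pick x := xget 1 [set a | A a /\ B' (x^-1 * a)].
rewrite -(size_map pick); apply: covers_finite_index => // a Aa.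
have [x xr B'xa] := cov a (AA' a Aa).
have [Ap B'xp] : A (pick x) /\ B' (x^-1 * pick x).
  exact: (@xgetPex _ 1 [set a | A a /\ B' (x^-1 * a)])
    (ex_intro _ a (conj Aa B'xa)).
exists (pick x); first exact: map_f.
apply: B'B => //; have -> : (pick x)^-1 * a = (x^-1 * pick x)^-1 * (x^-1 * a).
  by rewrite invgM invgK !mulgA mulgK.
by apply: (subgroupM sB') => //; exact: subgroupV.
Qed.

Lemma index_trans A B C : is_subgroup B -> is_subgroup C ->
  finite_index A B -> finite_index B C ->
  finite_index A C /\ (coset_index A C <= coset_index A B * coset_index B C)%N.
Proof.
move=> sB sC fAB fBC.
have [r [_ covr _ <-]] := index_transversal sB fAB.
have [q [_ covq _ <-]] := index_transversal sC fBC.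
rewrite -(size_allpairs (fun x y => x * y) r q).
apply: covers_finite_index => // a /covr[x xr /covq[y yq Cy]].
exists (x * y); first exact: allpairs_f.
by rewrite invgM -mulgA.
Qed.

Lemma index_mul_le A B C : is_subgroup A -> is_subgroup B -> is_subgroup C ->
  C `<=` B -> B `<=` A -> finite_index A C ->
  (coset_index A B * coset_index B C <= coset_index A C)%N.
Proof.
move=> sA sB sC CB BA fAC.
have [fAB _] : finite_index A B /\ (coset_index A B <= coset_index A C)%N.
  by apply: index_le => // x y _ _ /CB.
have [fBC _] : finite_index B C /\ (coset_index B C <= coset_index A C)%N.
  exact: index_le.
have [r [rA _ [ur sepr] <-]] := index_transversal sB fAB.
have [q [qB _ [uq sepq] <-]] := index_transversal sC fBC.
rewrite -(size_allpairs (fun x y => x * y) r q).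
have sep x y x' y' : x \in r -> y \in q -> x' \in r -> y' \in q ->
    C ((x * y)^-1 * (x' * y')) -> x = x' /\ y = y'.
  move=> xr yq x'r y'q; rewrite invgM mulgA -[y^-1 * _ * _]mulgA => Cxy.
  have xx' : x = x'.
    apply: sepr => //; have -> : x^-1 * x' =
      y * (y^-1 * (x^-1 * x') * y') * y'^-1 by rewrite !mulgA mulgV mul1g mulgK.
    apply: (subgroupM sB); last by apply: (subgroupV sB); exact: qB.
    by apply: (subgroupM sB); [exact: qB | exact: CB].
  split=> //; apply: sepq => //.
  by move: Cxy; rewrite xx' mulVg mulg1.
apply: distinct_leq_index => //.
  move=> _ /allpairsP[[x y] /= [xr yq ->]].
  by apply: (subgroupM sA); [exact: rA | apply: BA; exact: qB].
split.
  apply: allpairs_uniq => // -[x y] [x' y'].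
  move=> /allpairsP[[u v] /= [ur' vq [-> ->]]].
  move=> /allpairsP[[u' v'] /= [u'r v'q [-> ->]]] uv.
  have [|-> -> //] := sep u v u' v' ur' vq u'r v'q.
  by rewrite uv mulVg; exact: subgroup1.
move=> _ _ /allpairsP[[x y] /= [xr yq ->]] /allpairsP[[x' y'] /= [x'r y'q ->]].
by move=> /(sep _ _ _ _ xr yq x'r y'q)[-> ->].
Qed.

(** The pigeonhole principle for cosets. *)
Lemma index_eq_covers A A' B : is_subgroup B -> finite_index A B -> A' `<=` A ->
  (coset_index A B <= coset_index A' B)%N ->
  forall a, A a -> exists2 a', A' a' & B (a'^-1 * a).
Proof.
move=> sB fA A'A le_idx a Aa.
have sub : left_cosets A' B `<=` left_cosets A B.
  by move=> _ [x A'x <-]; exists x => //; exact: A'A.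
have fA' : finite_index A' B by exact: sub_finite_set fA.
have : left_cosets A' B (left_coset a B).
  suff -> : left_cosets A' B = left_cosets A B by exists a.
  apply: fset_set_inj => //; apply/eqP; rewrite eqEfcard le_idx andbT.
  by rewrite -fset_set_sub.
by case=> a' A'a' /(left_coset_eqP _ _ sB); exists a'.
Qed.

Lemma index1_sub A B : is_subgroup B -> A 1 -> finite_index A B ->
  (coset_index A B <= 1)%N -> A `<=` B.
Proof.
move=> sB A1 fA le1 a Aa.
have [||_ -> +] := @index_eq_covers A [set 1] B sB fA _ _ a Aa.
- by move=> _ ->.
- apply: leq_trans le1 _; apply: (@distinct_leq_index _ _ [:: 1]) => //.
  + by apply: sub_finite_set fA => _ [x -> <-]; exists 1.
  + by move=> x; rewrite inE => /eqP.
  + by split=> // x y; rewrite !inE => /eqP-> /eqP->.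
- by rewrite invg1 mul1g.
Qed.

Lemma index_gt0 A B : is_subgroup B -> A 1 -> finite_index A B ->
  (0 < coset_index A B)%N.
Proof.
move=> sB A1 fA; apply: (@distinct_leq_index A _ [:: 1]) => //.
  by move=> x; rewrite inE => /eqP->.
by split=> // x y; rewrite !inE => /eqP-> /eqP->.
Qed.
End Index.

(** * Compact open subgroups and automorphisms *)

(** The coercion from automorphisms to functions does not fire on products,
    inverses and powers, whose type is that of elements of a group. *)
Local Notation ap := topaut_fun.

Lemma nested_compact_nonempty (X : topologicalType) (A : set X)
    (F : nat -> set X) :
  compact A -> (forall k, closed (F k)) ->
  (forall k l, (k <= l)%N -> F l `<=` F k) ->
  (forall k, A `&` F k !=set0) -> exists2 x, A x & forall k, F k x.
Proof.
move=> cA cF decF /choice[u uP].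
have uA : (u @ \oo) A by exists 0%N => // k _; case: (uP k).
have [x [Ax clx]] := cA _ _ uA; exists x => // k.
apply: cF => B /clx; apply; exists k => // l kl.
by apply: decF kl _ _; case: (uP l).
Qed.

Section TopologicalGroup.
Variable G : topologicalGroupType.
Implicit Types (V W A : set G) (x y : G).

Lemma lmul_continuous x : continuous (fun y : G => x * y).
Proof.
move=> y; apply: (@continuous2_cvg _ _ _ _ _ _ _ _ (fun a b : G => a * b)).
- exact: (@mulg_continuous G (x, y)).
- exact: cvg_cst.
- exact: cvg_id.
Qed.

Lemma rmul_continuous x : continuous (fun y : G => y * x).
Proof.
move=> y; apply: (@continuous2_cvg _ _ _ _ _ _ _ _ (fun a b : G => a * b)).
- exact: (@mulg_continuous G (y, x)).
- exact: cvg_id.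
- exact: cvg_cst.
Qed.

Lemma left_cosetE x V : left_coset x V = (fun y => x^-1 * y) @^-1` V.
Proof.
apply/seteqP; split=> [_ [v Vv <-]|y Vy] /=; first by rewrite mulKg.
by exists (x^-1 * y); rewrite // mulVKg.
Qed.

Lemma left_coset_open x V : open V -> open (left_coset x V).
Proof.
move=> oV; rewrite left_cosetE; apply: open_comp => // y _.
exact: lmul_continuous.
Qed.

Lemma left_coset_compact x V : compact V -> compact (left_coset x V).
Proof.
move=> cV; apply: continuous_compact => //.
apply: continuous_subspaceT; exact: lmul_continuous.
Qed.

Lemma open_nbhs1_subgroup V : is_subgroup V -> nbhs 1 V -> open V.
Proof.
move=> sV V1; rewrite openE => x Vx; rewrite /interior.
have : nbhs x ((fun y => x^-1 * y) @^-1` V).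
  by apply: lmul_continuous; rewrite mulVg.
apply: filterS => y /= Vxy.
by rewrite -(mulVKg x y); exact: (subgroupM sV).
Qed.

Lemma open_subgroup_closed V : is_subgroup V -> open V -> closed V.
Proof.
move=> sV oV x clx.
have [|y [Vy [v Vv xv]]] := clx (left_coset x V).
  apply: open_nbhs_nbhs; split; first exact: left_coset_open.
  by exists 1; [exact: subgroup1 | rewrite mulg1].
have -> : x = y / v by rewrite -xv mulgK.
by apply: (subgroupM sV) => //; exact: subgroupV.
Qed.

(** Compactness in the form of near coverings, along the filter of finite
    sequences ordered by inclusion. *)
Lemma compact_finite_index A V : compact A -> is_subgroup V -> open V ->
  finite_index A V.
Proof.
move=> /compact_near_coveringP cA sV oV.
pose F : set_system (seq G) :=
  [set S | exists r : seq G, forall q : seq G, {subset r <= q} -> S q].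
have FF : Filter F.
  split; first by exists [::].
    move=> S S' [r rS] [r' r'S']; exists (r ++ r') => q rq.
    split; [apply: rS | apply: r'S'] => x xr;
      by apply: rq; rewrite mem_cat xr ?orbT.
  by move=> S S' SS' [r rS]; exists r => q /rS/SS'.
pose P (r : seq G) a := exists2 x, x \in r & V (x^-1 * a).
have nearP : forall a, A a -> \forall b \near a & r \near F, P r b.
  move=> a _; exists (left_coset a V, [set r | a \in r]) => /=.
    split; last by exists [:: a] => q; apply; rewrite inE.
    apply: open_nbhs_nbhs; split; first exact: left_coset_open.
    by exists 1; [exact: subgroup1 | rewrite mulg1].
  by case=> b r /= [[v Vv <-] ar]; exists a => //; rewrite mulKg.
have [r rP] := cA _ _ P FF nearP; have rcov : coset_cover A V r by exact: rP.
by have [] := covers_finite_index sV rcov.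
Qed.

Lemma compact_open_subgroupI V W : compact_open_subgroup V ->
  compact_open_subgroup W -> compact_open_subgroup (V `&` W).
Proof.
move=> [sV cV oV] [sW cW oW]; split; last exact: openI.
  apply/is_subgroupP; split; first by split; exact: subgroup1.
  move=> x y [Vx Wx] [Vy Wy]; split.
    by apply: (subgroupM sV) => //; exact: subgroupV.
  by apply: (subgroupM sW) => //; exact: subgroupV.
by apply: compact_closedI => //; exact: open_subgroup_closed.
Qed.

Section TopAut.
Implicit Types (a b : topaut G).

Lemma topautM a x y : a (x * y) = a x * a y.
Proof. by have [] := topautP a. Qed.

Lemma topaut1 a : a 1 = 1.
Proof. by apply: (@mulgI _ (a 1)); rewrite -topautM !mulg1. Qed.

Lemma topautV a x : a x^-1 = (a x)^-1.
Proof. by apply: (@mulgI _ (a x)); rewrite -topautM !mulgV topaut1. Qed.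

Lemma topaut_comp a b x : ap (a * b) x = a (b x).
Proof. by []. Qed.

Lemma topautK a x : ap a^-1 (a x) = x.
Proof. by rewrite -topaut_comp mulVg. Qed.

Lemma topautVK a x : a (ap a^-1 x) = x.
Proof. by rewrite -topaut_comp mulgV. Qed.

Lemma topaut_continuous a : continuous a.
Proof. by have [] := topautP a. Qed.

Lemma topaut_imageE a V : a @` V = ap a^-1 @^-1` V.
Proof.
apply/seteqP; split=> [_ [v Vv <-]|x Vx] /=; first by rewrite topautK.
by exists (ap a^-1 x); rewrite ?topautVK.
Qed.

Lemma image_topautM a b V : ap (a * b) @` V = a @` (b @` V).
Proof. by rewrite -image_comp. Qed.

Lemma preimage_subgroup a V : is_subgroup V -> is_subgroup (a @^-1` V).
Proof.
move=> sV; apply/is_subgroupP; split.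
  by rewrite /= topaut1; exact: subgroup1.
move=> x y /= Vx Vy; rewrite topautM topautV.
by apply: (subgroupM sV) => //; exact: subgroupV.
Qed.

Lemma image_subgroup a V : is_subgroup V -> is_subgroup (a @` V).
Proof. by rewrite topaut_imageE; exact: preimage_subgroup. Qed.

Lemma compact_open_image a V : compact_open_subgroup V ->
  compact_open_subgroup (a @` V).
Proof.
move=> [sV cV oV]; split; first exact: image_subgroup.
  apply: continuous_compact => //; apply: continuous_subspaceT.
  exact: topaut_continuous.
by rewrite topaut_imageE; apply: open_comp => // x _; exact: topaut_continuous.
Qed.

Lemma index_image a A V : is_subgroup V -> finite_index A V ->
  coset_index (a @` A) (a @` V) = coset_index A V.
Proof.
suff le b B W : is_subgroup W -> finite_index B W ->
    finite_index (b @` B) (b @` W) /\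
    (coset_index (b @` B) (b @` W) <= coset_index B W)%N.
  move=> sV fAV; have [faAV le1] := le a A V sV fAV.
  have := le a^-1 _ _ (image_subgroup a sV) faAV.
  rewrite -!image_topautM mulVg !image_id => -[_ le2].
  by apply/eqP; rewrite eqn_leq le1.
move=> sW fBW; have [r [_ cov _ <-]] := index_transversal sW fBW.
rewrite -(size_map b); apply: covers_finite_index; first exact: image_subgroup.
move=> _ [x Bx <-]; have [y yr Wyx] := cov x Bx.
exists (b y); first exact: map_f.
by exists (y^-1 * x); rewrite // topautM topautV.
Qed.

(** The cosets of [a(V) `&` V] in a(V) correspond to the cosets of V that meet
    a(V), and there are finitely many of them by compactness. *)
Lemma displacement_index a V W : compact_open_subgroup V ->
  compact_open_subgroup W ->
  (displacement_cosets a V #<= displacement_cosets a W)%card ->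
  (coset_index (a @` V) V <= coset_index (a @` W) W)%N.
Proof.
have eq1 U : compact_open_subgroup U ->
  finite_set (displacement_cosets a U) /\
    coset_index (a @` U) U = coset_index (a @` U) (a @` U `&` U).
  move=> coU; have [saU caU oaU] := compact_open_image a coU.
  have [sI cI oI] := compact_open_subgroupI (compact_open_image a coU) coU.
  have [sU cU oU] := coU.
  have fI := compact_finite_index caU sI oI.
  split=> //; apply/eqP; rewrite eqn_leq; apply/andP; split.
    by case: (@index_le _ (a @` U) U (a @` U) (a @` U `&` U)) => // x y _ _ [].
  case: (@index_le _ (a @` U) (a @` U `&` U) (a @` U) U) => //.
    exact: compact_finite_index.
  move=> x y ax ay Uxy; split=> //; apply: (subgroupM saU) => //.
  exact: subgroupV.
move=> coV coW.
have [fV ->] := eq1 _ coV; have [fW ->] := eq1 _ coW => le.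
have /finite_setP[n Wn] := fW.
rewrite /coset_index (card_fset_set Wn); apply: geq_card_fset_set.
by rewrite -(card_le_eqr Wn).
Qed.

End TopAut.
End TopologicalGroup.

(** * Enclosing a subgroup in a compact open one *)
Section Envelope.
Variable G : topologicalGroupType.
Implicit Types (V L : set G) (x y : G).

(** The set C = L V is a finite union of cosets of V, hence compact, and the
    group S of the g with g C = C is contained in C. It contains L, and it is
    open since it contains an intersection of finitely many conjugates
    l V l^-1. *)
Lemma compact_open_envelope V L : compact_open_subgroup V -> is_subgroup L ->
  finite_index L V -> exists2 S, compact_open_subgroup S & L `<=` S.
Proof.
move=> [sV cV oV] sL fLV.
have [r [rL cov _ _]] := index_transversal sV fLV.
pose C := [set x : G | exists2 l, L l & V (l^-1 * x)].
pose S := [set g : G | forall x, C (g * x) <-> C x].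
have sS : is_subgroup S.
  apply/is_subgroupP; split=> [x|g h Sg Sh x]; first by rewrite mul1g.
  by rewrite -mulgA Sg -(Sh (h^-1 * x)) mulVKg.
have C1 : C 1 by exists 1; rewrite ?mulg1 ?invg1; exact: subgroup1.
have SC : S `<=` C by move=> g /(_ 1); rewrite mulg1 => ->.
have oS : open S.
  apply: open_nbhs1_subgroup => //.
  have nearr : \forall g \near (1 : G), forall l, l \in r -> V (l^-1 * g * l).
    elim: {rL cov} r => [|l r near_r]; first by near=> g.
    have near_l : \forall g \near (1 : G), V (l^-1 * g * l).
      have : nbhs (1 : G)
          ((fun g => l^-1 * g) @^-1` ((fun g => g * l) @^-1` V)).
        apply: lmul_continuous; rewrite mulg1; apply: rmul_continuous.
        rewrite mulVg; apply: open_nbhs_nbhs; split=> //; exact: subgroup1.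
      by apply: filterS => g.
    apply: filterS2 near_l near_r => g Vl Vr k; rewrite inE => /orP[/eqP->//|].
    exact: Vr.
  have half g : (forall l, l \in r -> V (l^-1 * g * l)) ->
      forall x, C x -> C (g * x).
    move=> Vg x [l Ll Vlx]; have [k kr Vkl] := cov l Ll.
    exists k; first exact: rL.
    have -> : k^-1 * (g * x) = k^-1 * g * k * (k^-1 * l * (l^-1 * x)).
      by rewrite !mulgA mulgK mulgK.
    apply: (subgroupM sV); first exact: Vg.
    exact: (subgroupM sV).
  apply: filterS nearr => g Vg x; split; last exact: half.
  rewrite -{2}(mulKg g x); apply: half => l lr.
  have -> : l^-1 * g^-1 * l = (l^-1 * g * l)^-1.
    by rewrite !invgM invgK mulgA.
  exact/(subgroupV sV)/Vg.
exists S; last first.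
  move=> l Ll x; split=> [[k Lk Vk]|[k Lk Vk]].
    exists (l^-1 * k); first by apply: (subgroupM sL) => //; exact: subgroupV.
    by rewrite invgM invgK -mulgA.
  exists (l * k); first exact: (subgroupM sL).
  by rewrite invgM -mulgA mulKg.
split=> //.
apply: (@subclosed_compact _ _ (\bigcup_(l in [set` r]) left_coset l V)).
- exact: open_subgroup_closed.
- rewrite bigcup_seq; apply: bigsetU_compact => l _.
  exact: left_coset_compact.
- move=> g /SC[l Ll Vlg]; have [k kr Vkl] := cov l Ll.
  exists k => //; exists (k^-1 * l * (l^-1 * g)); first exact: (subgroupM sV).
  by rewrite !mulgA mulgK mulgV mul1g.
Unshelve. all: by end_near.
Qed.
End Envelope.

(** * Orbits relative to a compact open subgroup *)
Section Dynamics.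
Variable G : topologicalGroupType.
Implicit Types (a : topaut G) (V W S : set G) (x y : G).

Lemma topautXD a i j x : ap (a ^+ (i + j)) x = ap (a ^+ i) (ap (a ^+ j) x).
Proof. by rewrite expgnDr. Qed.

Lemma topautXS a i x : ap (a ^+ i.+1) x = ap (a ^+ i) (a x).
Proof. by rewrite expgSr. Qed.

Lemma topautXK a i x : ap (a^-1 ^+ i) (ap (a ^+ i) x) = x.
Proof. by rewrite expVgn topautK. Qed.

Lemma topautXVK a i x : ap (a ^+ i) (ap (a^-1 ^+ i) x) = x.
Proof. by rewrite expVgn topautVK. Qed.

(** For [a^-1] in place of a, this is the intersection of the subgroups a^i(V)
    for i <= n. *)
Definition stays a V n : set G :=
  [set x | forall i, (i <= n)%N -> V (ap (a ^+ i) x)].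

Definition homoclinic a V : set G := [set x | exists N, forall i, (N <= i)%N ->
  V (ap (a ^+ i) x) /\ V (ap (a^-1 ^+ i) x)].

Lemma stays0 a V : stays a V 0 = V.
Proof.
apply/seteqP; split=> [x /(_ 0%N)|x Vx i]; first exact.
by rewrite leqn0 => /eqP->.
Qed.

Lemma staysS a V n : stays a V n.+1 = V `&` (a @^-1` stays a V n).
Proof.
apply/seteqP; split=> [x Vx|x [Vx Vax] [|i] // le_in].
  split; first exact: (Vx 0%N).
  by move=> i le_in; rewrite -topautXS; exact: Vx.
by rewrite topautXS; exact: Vax.
Qed.

Lemma stays_sub a V n : stays a V n `<=` V.
Proof. by move=> x /(_ 0%N); exact. Qed.

Lemma compact_open_stays a V n : compact_open_subgroup V ->
  compact_open_subgroup (stays a V n).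
Proof.
move=> coV; elim: n => [|n IH]; first by rewrite stays0.
rewrite staysS; apply: compact_open_subgroupI => //.
by have := compact_open_image a^-1 IH; rewrite topaut_imageE invgK.
Qed.

Lemma image_stays a V n :
  ap a @` stays a^-1 V n `&` V = stays a^-1 V n.+1.
Proof. by rewrite staysS topaut_imageE setIC. Qed.

(** Passing from a^m(S) down to the intersection of the a^i(S), i <= m, one
    intersects with one more a^i(S) at a time; up to a power of a, each step
    is the displacement by a of the compact open group [stays a^-1 S i]. *)
Lemma index_stays_growth a d S m :
  (forall W, compact_open_subgroup W -> d <= coset_index (a @` W) W)%N ->
  compact_open_subgroup S ->
  (d ^ m <= coset_index (ap (a ^+ m) @` S) (stays a^-1 S m))%N.
Proof.
move=> dmin coS; elim: m => [|m IH].
  rewrite expn0 stays0 image_id; have [sS cS oS] := coS.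
  by apply: index_gt0 => //; [exact: subgroup1 | exact: compact_finite_index].
have coD := compact_open_stays a^-1 m coS.
have coD' := compact_open_stays a^-1 m.+1 coS.
have [sD cD oD] := coD; have [sD' cD' oD'] := coD'.
have [saD caD oaD] := compact_open_image a coD.
have [sE cE oE] := compact_open_image (a ^+ m.+1) coS.
have [sEm cEm oEm] := compact_open_image (a ^+ m) coS.
apply: (@leq_trans (coset_index (ap (a ^+ m.+1) @` S) (a @` stays a^-1 S m) *
                    coset_index (a @` stays a^-1 S m) (stays a^-1 S m.+1))).
  rewrite expnSr; apply: leq_mul.
    rewrite expgS image_topautM index_image //; exact: compact_finite_index.
  apply: leq_trans (dmin _ coD) _.
  apply: (proj2 (index_le _ _ _ _ _)) => //; first exact: compact_finite_index.
  by move=> x y _ _ xy i le_im; apply: xy; exact: leqW.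
apply: index_mul_le => //; last exact: compact_finite_index.
  by rewrite -image_stays => x [].
move=> _ [x Dx <-]; rewrite topaut_imageE /=.
have -> : ap (a ^+ m.+1)^-1 (a x) = ap (a^-1 ^+ m) x.
  by rewrite -expVgn topautXS topautK.
exact: Dx.
Qed.

Lemma homoclinic_subgroup a V : is_subgroup V -> is_subgroup (homoclinic a V).
Proof.
move=> sV; apply/is_subgroupP; split.
  by exists 0%N => i _; rewrite !topaut1; split; exact: subgroup1.
move=> x y [N xN] [M yM]; exists (maxn N M) => i.
rewrite geq_max => /andP[Ni Mi].
have [Vx V'x] := xN i Ni; have [Vy V'y] := yM i Mi.
rewrite !topautM !topautV.
by split; apply: (subgroupM sV) => //; exact: subgroupV.
Qed.

Lemma homoclinicV a V : homoclinic a^-1 V = homoclinic a V.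
Proof.
by apply/seteqP; split=> x [N xN]; exists N => i /xN []; rewrite invgK.
Qed.

Lemma homoclinic_stable a V x : homoclinic a V x -> homoclinic a V (a x).
Proof.
move=> [N xN]; exists N.+1 => -[//|i] Ni; split.
  by rewrite -topautXS; apply: (proj1 (xN _ _)); lia.
by rewrite topautXS topautK; apply: (proj2 (xN _ _)).
Qed.

Lemma homoclinic_stableX a V n x : homoclinic a V x ->
  homoclinic a V (ap (a ^+ n) x).
Proof.
by move=> Lx; elim: n => // n IH; rewrite expgS; exact: homoclinic_stable.
Qed.

Lemma homoclinic_stableVX a V n x : homoclinic a V x ->
  homoclinic a V (ap (a^-1 ^+ n) x).
Proof. by rewrite -homoclinicV; exact: homoclinic_stableX. Qed.

Lemma eventually_all (I : eqType) (r : seq I) (P : I -> nat -> Prop) :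
  (forall x : I, x \in r -> exists N, forall i, (N <= i)%N -> P x i) ->
  exists N, forall x : I, x \in r -> forall i, (N <= i)%N -> P x i.
Proof.
elim: r => [|x r IH] ev; first by exists 0%N.
have [y yr|N rN] := IH; first by apply: ev; rewrite inE yr orbT.
have [|M xM] := ev x; first by rewrite inE eqxx.
exists (maxn N M) => y; rewrite inE => yr i; rewrite geq_max => /andP[Ni Mi].
by case/orP: yr => [/eqP->|yr]; [exact: xM | exact: rN].
Qed.

(** Let L be the group of homoclinic points and A the group of those whose
    backward orbit is in V; L is the increasing union of the a^k(A). Finitely
    many cosets of A cover a(A), and their representatives, which belong to L,
    have forward orbits that are in V from some time n on. Inductively, every
    a^(n+k)(A) is contained in V a^n(A): each further application of a only
    creates factors whose forward orbit is in V. Taking inverses, L is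
    contained in a^n(A) V, and a^n(A) is part of the compact set a^n(V). *)
Lemma homoclinic_finite_index a V : compact_open_subgroup V ->
  finite_index (homoclinic a V) V.
Proof.
move=> coV; have [sV cV oV] := coV; set L := homoclinic a V.
have sL : is_subgroup L by exact: homoclinic_subgroup.
pose A := [set x | L x /\ forall i, V (ap (a^-1 ^+ i) x)].
have sA : is_subgroup A.
  apply/is_subgroupP; split.
    by split=> [|i]; rewrite ?topaut1; exact: subgroup1.
  move=> x y [Lx Vx] [Ly Vy]; split=> [|i].
    by apply: (subgroupM sL) => //; exact: subgroupV.
  by rewrite topautM topautV; apply: (subgroupM sV) => //; exact: subgroupV.
have fA : finite_index (a @` A) A.
  have [saV caV oaV] := compact_open_image a coV.
  have faV : finite_index (a @` V) V by exact: compact_finite_index.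
  apply: (proj1 (index_le _ _ faV _ _)) => //.
    by move=> _ [x [_ /(_ 0%N) Vx] <-]; exists x.
  move=> _ _ [x [Lx Vx] <-] [y [Ly Vy] <-] Vxy; split.
    apply: (subgroupM sL); last exact: homoclinic_stable.
    by apply: (subgroupV sL); exact: homoclinic_stable.
  move=> [|i] //; rewrite topautM topautV !topautXS !topautK.
  by apply: (subgroupM sV) => //; exact: subgroupV.
have [r [rA cov _ _]] := index_transversal sA fA.
have [n rn] : exists n, forall x, x \in r -> forall i, (n <= i)%N ->
    V (ap (a ^+ i) x).
  apply: eventually_all => x /rA[y [Ly _] <-].
  by have [N yN] := homoclinic_stable Ly; exists N => i /yN[].
have split_A k x : A x -> exists v z, [/\ forall i, V (ap (a ^+ i) v), V z
    & ap (a ^+ (n + k)) x = v * ap (a ^+ n) z].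
  move=> Ax; suff [v [z [Vv [_ Az] ->]]] : exists v z,
      [/\ forall i, V (ap (a ^+ i) v), A z
        & ap (a ^+ (n + k)) x = v * ap (a ^+ n) z].
    by exists v, z; split=> //; exact: (Az 0%N).
  elim: k => [|k [v [z [Vv Az xE]]]].
    exists 1, x; rewrite addn0 mul1g; split=> // i.
    by rewrite topaut1; exact: subgroup1.
  have [y yr Ayz] := cov (a z) (ex_intro2 _ _ z Az erefl).
  exists (a v * ap (a ^+ n) y), (y^-1 * a z); split=> // [i|].
    rewrite topautM -topautXS -topautXD; apply: (subgroupM sV); first exact: Vv.
    by apply: rn => //; exact: leq_addl.
  rewrite -mulgA -topautM mulVKg addnS expgS topaut_comp xE topautM.
  by rewrite -!topaut_comp -expgS -expgSr.
have LV x : L x -> exists2 z, (ap (a ^+ n) @` V) z & V (z^-1 * x).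
  move=> Lx; have [N xN] := subgroupV sL Lx.
  pose y := ap (a^-1 ^+ (n + N)) x^-1.
  have Ay : A y.
    split=> [|i]; first exact: homoclinic_stableVX (subgroupV sL Lx).
    rewrite /y -topautXD; apply: (proj2 (xN _ _)); lia.
  have [v [z [Vv Vz]]] := split_A N y Ay; rewrite /y topautXVK => xE.
  exists (ap (a ^+ n) z^-1); first by exists z^-1 => //; exact: subgroupV.
  have -> : (ap (a ^+ n) z^-1)^-1 * x = v^-1.
    by rewrite topautV invgK -[x]invgK xE invgM mulVKg.
  exact: subgroupV sV (Vv 0%N).
have [sX cX oX] := compact_open_image (a ^+ n) coV.
apply: sub_finite_set (compact_finite_index cX sV oV).
move=> _ [x /LV[z Xz Vzx] <-]; exists z => //.
exact/left_coset_eqP.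
Qed.

End Dynamics.

(** * The scale of powers of an automorphism *)

Section Scale.
Variable G : topologicalGroupType.
Implicit Types (a : topaut G) (V W S : set G) (x y : G).

(** If no D_j, the intersection of the a^i(O) with i <= j, is displaced less
    than O, then a(D_j) meets every coset of O in a(O). Hence any x in O can be
    corrected by an element of D_j so that its image by a stays in O. Iterating
    this with ever larger j gives factorisations for finitely many times, and
    compactness of O gives one for all times. *)
Lemma factor_of_minimal a O : compact_open_subgroup O ->
  (forall j, coset_index (a @` O) O <=
    coset_index (a @` stays a^-1 O j) (stays a^-1 O j))%N ->
  forall x, O x -> exists u,
    (forall i, O (ap (a^-1 ^+ i) u)) /\ forall i, O (ap (a ^+ i) (u^-1 * x)).
Proof.
move=> coO minO; have [sO cO oO] := coO; pose D := stays a^-1 O.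
have coD j : compact_open_subgroup (D j) by exact: compact_open_stays.
have sD j : is_subgroup (D j) by case: (coD j).
have DO j : D j `<=` O by exact: stays_sub.
have one_step j x : O x -> exists d,
    [/\ D j d, O (d^-1 * x) & O (ap a (d^-1 * x))].
  move=> Ox; have [saO caO oaO] := compact_open_image a coO.
  have [saD caD oaD] := compact_open_image a (coD j).
  have faO : finite_index (a @` O) O by exact: compact_finite_index.
  have sub : a @` D j `<=` a @` O by apply: image_subset; exact: DO.
  have le_idx : (coset_index (a @` O) O <= coset_index (a @` D j) O)%N.
    apply: leq_trans (minO j) _; apply: (proj2 (index_le _ _ _ _ _)) => //.
      exact: compact_finite_index.
    move=> y z Dy Dz Oyz i le_ij.
    have : D j.+1 (y^-1 * z).
      rewrite /D -image_stays; split=> //.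
      by apply: (subgroupM saD) => //; exact: subgroupV.
    by apply; exact: leqW.
  have [_ [d Dd <-] Oadx] :=
    index_eq_covers sO faO sub le_idx (ex_intro2 _ _ x Ox erefl).
  exists d; split=> //; last by rewrite topautM topautV.
  by apply: (subgroupM sO) => //; apply: (subgroupV sO); exact: DO Dd.
have finite_steps k j x : O x -> exists2 d, D j d & stays a O k (d^-1 * x).
  elim: k j x => [|k IH] j x Ox.
    by have [d [Dd Odx _]] := one_step j x Ox; exists d; rewrite ?stays0.
  have [d [Dd Odx Oadx]] := one_step j x Ox.
  have [e De Oe] := IH j.+1 _ Oadx.
  have De' : D j (ap a^-1 e) by move: De; rewrite /D staysS => -[].
  exists (d * ap a^-1 e); first exact: (subgroupM (sD j)).
  have -> : (d * ap a^-1 e)^-1 * x = ap a^-1 (e^-1 * ap a (d^-1 * x)).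
    by rewrite topautM topautK topautV invgM mulgA.
  rewrite staysS; split; last by rewrite /= topautVK.
  rewrite topautM topautK topautV; apply: (subgroupM sO) => //.
  by apply: (subgroupV sO); exact: DO De'.
move=> x Ox; pose F k := [set u | D k u /\ stays a O k (u^-1 * x)].
have [||k|u _ Fu] := @nested_compact_nonempty _ O F cO.
- move=> k; apply: closedI; first by apply: open_subgroup_closed; case: (coD k).
  apply: (@preimage_closed _ _ (fun u => u^-1 * x) (stays a O k)).
    move=> u _.
    apply: (@continuous_comp _ _ _ (fun u : G => u^-1) (fun u => u * x)).
      exact: invg_continuous.
    exact: rmul_continuous.
  by have [? _ ?] := compact_open_stays a k coO; exact: open_subgroup_closed.
- move=> k l kl u [Du Oux]; split=> i ik; [apply: Du | apply: Oux];
  exact: leq_trans kl.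
- have [d Dd Odx] := finite_steps k k x Ox; exists d; split=> //; exact: DO Dd.
by exists u; split=> i; have [Du Oux] := Fu i; [apply: Du | apply: Oux].
Qed.

Lemma ex_min_nat (P : nat -> Prop) : (exists n, P n) ->
  exists2 n, P n & forall m, P m -> (n <= m)%N.
Proof.
move=> exP; have exP' : exists n, `[< P n >].
  by case: exP => n /asboolP; exists n.
case: (ex_minnP exP') => n /asboolP Pn minn; exists n => // m /asboolP.
exact: minn.
Qed.

(** The passage from U to the smaller group O and its enlargement S costs only
    constant indices. The point of the choice of O and S is that [a^m(O) `&` O]
    is contained in a^i(S) for all i <= m. *)
Lemma scale_growth a d U : compact_open_subgroup U ->
  (forall W, compact_open_subgroup W -> d <= coset_index (a @` W) W)%N ->
  exists C, forall m, (d ^ m <= C * coset_index (ap (a ^+ m) @` U) U)%N.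
Proof.
move=> coU dmin; have [sU cU oU] := coU; set L := homoclinic a U.
have sL : is_subgroup L by exact: homoclinic_subgroup.
have [S coS LS] := compact_open_envelope coU sL (homoclinic_finite_index a coU).
have [sS cS oS] := coS.
pose P n := exists O, [/\ compact_open_subgroup O, O `<=` U `&` S
  & coset_index (a @` O) O = n].
have [|_ [O [coO OUS <-]] minO] := @ex_min_nat P.
  exists (coset_index (a @` (U `&` S)) (U `&` S)), (U `&` S); split=> //.
  exact: compact_open_subgroupI.
have [sO cO oO] := coO.
have factor := @factor_of_minimal a O coO.
have {}factor : forall x, O x -> exists u,
    (forall i, O (ap (a^-1 ^+ i) u)) /\ forall i, O (ap (a ^+ i) (u^-1 * x)).
  apply: factor => j; apply: minO; exists (stays a^-1 O j); split=> //.
    exact: compact_open_stays.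
  by move=> x /stays_sub; exact: OUS.
(* Write a^-m x = u w. Then a^m w does not leave O up to time m, and the inverse
   of g = a^m u factors as v p, where the orbit of p is in O at all times
   but those between -m and 0: this is the excursion, and it belongs to L. *)
have returns m x : O x -> O (ap (a^-1 ^+ m) x) -> stays a^-1 S m x.
  move=> Ox Oy; have [u [Ou Ow]] := factor _ Oy.
  pose z := ap (a ^+ m) (u^-1 * ap (a^-1 ^+ m) x).
  have Oz i : (i <= m)%N -> O (ap (a^-1 ^+ i) z).
    by move=> im; rewrite /z -{1}(subnKC im) topautXD topautXK; exact: Ow.
  pose g := ap (a ^+ m) u.
  have xE : x = g * z by rewrite /g /z topautM topautV mulVKg topautXVK.
  have Og : O g.
    have -> : g = x * z^-1 by rewrite xE mulgK.
    by apply: (subgroupM sO) => //; apply: (subgroupV sO); exact: (Oz 0%N).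
  have [v [Ov Op]] := factor _ (subgroupV sO Og).
  pose p := v^-1 * g^-1.
  have Lp : L p.
    exists m => i mi; split; first by case: (OUS _ (Op i)).
    rewrite /p topautM !topautV.
    suff : O ((ap (a^-1 ^+ i) v)^-1 * (ap (a^-1 ^+ i) g)^-1) by case/OUS.
    apply: (subgroupM sO); apply: (subgroupV sO); first exact: Ov.
    by rewrite /g -(subnK mi) topautXD topautXK; exact: Ou.
  have [sSm _ _] := compact_open_stays a^-1 m coS.
  have -> : x = p^-1 * v^-1 * z by rewrite xE /p invgM !invgK mulgK.
  have Sp : stays a^-1 S m p.
    by move=> i _; apply: LS; exact: homoclinic_stableVX.
  have Sv : stays a^-1 S m v by move=> i _; case: (OUS _ (Ov i)).
  have Sz : stays a^-1 S m z by move=> i /Oz/OUS[].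
  apply: (subgroupM sSm) => //.
  by apply: (subgroupM sSm); exact: (subgroupV sSm).
pose C := (coset_index S O * (coset_index O U * coset_index U O))%N.
exists C => m; have [sSm cSm oSm] := compact_open_stays a^-1 m coS.
have [saS caS oaS] := compact_open_image (a ^+ m) coS.
have [saO caO oaO] := compact_open_image (a ^+ m) coO.
have [saU caU oaU] := compact_open_image (a ^+ m) coU.
have fi A B : compact A -> is_subgroup B -> open B -> finite_index A B.
  exact: compact_finite_index.
apply: leq_trans (index_stays_growth m dmin coS) _.
have /leq_trans -> // : (coset_index (ap (a ^+ m) @` S) (stays a^-1 S m) <=
    coset_index S O * coset_index (ap (a ^+ m) @` O) O)%N.
  rewrite -(@index_image _ (a ^+ m) S O) //; last exact: fi.
  have [||_ /leq_trans->//] :=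
    @index_trans _ (ap (a ^+ m) @` S) (ap (a ^+ m) @` O) (stays a^-1 S m)
      saO sSm; [exact: fi..|].
  rewrite leq_mul2l; apply/orP; right.
  apply: (proj2 (index_le _ _ _ _ _)) => //; first exact: fi.
  move=> x y Ox Oy Oxy; apply: returns => //.
  have : (ap (a ^+ m) @` O) (x^-1 * y).
    by apply: (subgroupM saO) => //; exact: (subgroupV saO).
  by rewrite topaut_imageE expVgn.
rewrite -mulnA leq_mul2l; apply/orP; right.
have [||_ h1] := @index_trans _ (ap (a ^+ m) @` O) (ap (a ^+ m) @` U) O saU sO;
  [exact: fi..|].
have [||_ h2] := @index_trans _ (ap (a ^+ m) @` U) U O sU sO; [exact: fi..|].
rewrite index_image // in h1; last exact: fi.
apply: leq_trans h1 _; rewrite -mulnA leq_mul2l; apply/orP; right.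
by rewrite mulnC.
Qed.

Lemma index_image_mul (a b : topaut G) U : compact_open_subgroup U ->
  (coset_index (ap (a * b)%g @` U) U <=
    coset_index (a @` U) U * coset_index (b @` U) U)%N.
Proof.
move=> coU; have [sU cU oU] := coU.
have [sa ca oa] := compact_open_image a coU.
have [sb cb ob] := compact_open_image b coU.
have [sab cab oab] := compact_open_image a (compact_open_image b coU).
rewrite image_topautM mulnC -(@index_image _ a (b @` U) U) //; last first.
  exact: compact_finite_index.
by apply: (proj2 (index_trans _ _ _ _)) => //; exact: compact_finite_index.
Qed.

Lemma index_image_exp_le a U n : compact_open_subgroup U ->
  (coset_index (ap (a ^+ n) @` U) U <= coset_index (a @` U) U ^ n)%N.
Proof.
move=> coU; have [sU cU oU] := coU.
elim: n => [|n IH].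
  rewrite image_id expn0; have [|//] := @covers_finite_index _ U U [:: 1] sU.
  by move=> x Ux; exists 1; rewrite ?inE // invg1 mul1g.
rewrite expgS expnS; apply: leq_trans (index_image_mul _ _ coU) _.
by rewrite leq_mul2l IH orbT.
Qed.

(** Both bounds for a^n are compared on the powers a^(n m), where the constant
    of [scale_growth] does not matter. *)
Lemma index_image_exp a U n : compact_open_subgroup U ->
  (forall W, compact_open_subgroup W ->
    coset_index (a @` U) U <= coset_index (a @` W) W)%N ->
  coset_index (ap (a ^+ n) @` U) U = (coset_index (a @` U) U ^ n)%N.
Proof.
move=> coU minU; apply/eqP; rewrite eqn_leq index_image_exp_le //=.
have [C growth] := scale_growth coU minU.
apply: (@leq_of_expn_leq _ _ C) => m; exists m => //.
rewrite -expnM; apply: leq_trans (growth _) _; rewrite leq_mul2l expgnA.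
by rewrite index_image_exp_le // orbT.
Qed.
End Scale.

(** * The quotient by the stabiliser *)
Section Quotient.
Variables (G : topologicalGroupType) (H : set (topaut G)) (U : set G).
Hypotheses (sH : is_subgroup H) (coU : compact_open_subgroup U).
Hypothesis tidyU : tidy_for H U.

Let minU (a : topaut G) : H a -> forall W, compact_open_subgroup W ->
  (coset_index (a @` U) U <= coset_index (a @` W) W)%N.
Proof.
move=> /tidyU[_ min] W coW.
by apply: displacement_index => //; exact: min.
Qed.

Lemma index_eq1_stabilizes (a : topaut G) : coset_index (a @` U) U = 1%N ->
  coset_index (ap a^-1 @` U) U = 1%N -> a @` U = U.
Proof.
have sub (b : topaut G) : coset_index (b @` U) U = 1%N -> b @` U `<=` U.
  move=> b1; have [sU cU oU] := coU.
  have [sb cb ob] := compact_open_image b coU.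
  apply: index1_sub => //; last by rewrite b1.
    exact: subgroup1.
  exact: compact_finite_index.
move=> /sub aU /sub a'U; apply/seteqP; split=> // x Ux.
by exists (ap a^-1 x); rewrite ?topautVK //; apply: a'U; exists x.
Qed.

Lemma image_fixV (b : topaut G) : b @` U = U -> ap b^-1 @` U = U.
Proof. by move=> bU; rewrite -{1}bU -image_topautM mulVg image_id. Qed.

(** If c fixes U, then the conjugate of c by a fixes a^-1(U), so its least
    displacement is 1; as U is minimising, U attains it. *)
Lemma set_stabilizer_normal : is_normal (set_stabilizer H U) H.
Proof.
split.
- apply/is_subgroupP; split.
    by split; [exact: subgroup1 | exact: image_id].
  move=> a b [Ha aU] [Hb bU]; split.
    by apply: (subgroupM sH) => //; exact: (subgroupV sH).
  by rewrite image_topautM image_fixV.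
- by move=> a [].
move=> a b Ha [Hb bU].
have HVa := subgroupV sH Ha.
have HJ (c : topaut G) : H c -> H (c ^ a).
  by move=> Hc; rewrite conjgE; do 2?[apply: (subgroupM sH) => //].
have one (c : topaut G) : H c -> c @` U = U ->
    coset_index (ap (c ^ a) @` U) U = 1%N.
  move=> Hc cU; apply/eqP; rewrite eqn_leq; apply/andP; split; last first.
    have [sU cpU oU] := coU; have [sI cI oI] := compact_open_image (c ^ a) coU.
    by apply: index_gt0 => //; [exact: subgroup1 | exact: compact_finite_index].
  have coW := compact_open_image a^-1 coU.
  apply: leq_trans (minU (HJ _ Hc) coW) _.
  rewrite -image_topautM conjgE !mulgA mulgK image_topautM cU.
  have [sW cW oW] := coW.
  have [|//] := @covers_finite_index _ (ap a^-1 @` U) (ap a^-1 @` U) [:: 1] sW.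
  by move=> x Wx; exists 1; rewrite ?inE // invg1 mul1g.
split; first exact: HJ.
apply: index_eq1_stabilizes; first exact: one.
rewrite -conjVg; apply: one; first exact: (subgroupV sH).
exact: image_fixV.
Qed.

Variable nN : is_normal (set_stabilizer H U) H.
Local Notation Q := (quotient sH nN).

Let rep (X : Q) : topaut G :=
  xget 1 [set a | H a /\ left_coset a (set_stabilizer H U) = val X].

Let repP X : H (rep X) /\ left_coset (rep X) (set_stabilizer H U) = val X.
Proof.
have [a Ha aX] := set_mem (valP X).
exact: (@xgetPex _ 1 [set a | H a /\ left_coset a (set_stabilizer H U) = val X])
  (ex_intro _ a (conj Ha aX)).
Qed.

Definition quotient_scale (X : Q) : nat := coset_index (rep X @` U) U.

(** The stabiliser multiplies a on the right, so it is applied to U before a. *)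
Lemma quotient_scaleE (X : Q) (a : topaut G) :
  left_coset a (set_stabilizer H U) = val X ->
  quotient_scale X = coset_index (a @` U) U.
Proof.
have [sN _ _] := nN; have [_ <-] := repP X => /(left_coset_eqP _ _ sN)[_ eU].
by rewrite /quotient_scale -[rep X](mulVKg a) image_topautM eU.
Qed.

Lemma val_quotientM (X Y : Q) a b : H b ->
  left_coset a (set_stabilizer H U) = val X ->
  left_coset b (set_stabilizer H U) = val Y ->
  left_coset (a * b) (set_stabilizer H U) = val (X * Y).
Proof. by move=> Hb aX bY; rewrite -(left_cosetM nN _ Hb) aX bY. Qed.

Lemma quotient_scaleM (X Y : Q) :
  (quotient_scale (X * Y)%g <= quotient_scale X * quotient_scale Y)%N.
Proof.
have [Hx xX] := repP X; have [Hy yY] := repP Y.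
by rewrite (quotient_scaleE (val_quotientM Hy xX yY)); exact: index_image_mul.
Qed.

Lemma quotient_scaleX (X : Q) n :
  quotient_scale (X ^+ n) = (quotient_scale X ^ n)%N.
Proof.
have [Hx xX] := repP X.
have powX : left_coset (rep X ^+ n) (set_stabilizer H U) = val (X ^+ n).
  elim: n => [|n IH]; first by rewrite !expg0 left_coset1.
  by rewrite !expgSr; exact: val_quotientM.
by rewrite (quotient_scaleE powX); apply: index_image_exp => //; exact: minU.
Qed.

Lemma quotient_scale_eq1 (X : Q) :
  quotient_scale X = 1%N -> quotient_scale X^-1 = 1%N -> X = 1.
Proof.
have [Hx xX] := repP X; have [sN _ _] := nN.
have xVX : left_coset (rep X)^-1 (set_stabilizer H U) = val X^-1.
  by rewrite -(left_cosetV nN sH Hx) xX.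
rewrite (quotient_scaleE xVX) /quotient_scale => X1 XV1.
apply: val_inj; rewrite -xX -[RHS]left_coset1; apply/left_coset_eqP => //.
have NX : set_stabilizer H U (rep X) by split=> //; exact: index_eq1_stabilizes.
by rewrite mulg1; exact: (subgroupV sN).
Qed.
End Quotient.

Theorem theorem4p15 (G : topologicalGroupType)
    (td_G : totally_disconnected [set: G]) (lc_G : locally_compact [set: G])
    (H : set (topaut G)) (sH : is_subgroup H)
    (U : set G) (coU : compact_open_subgroup U) (tidyU : tidy_for H U) :
  exists nN : is_normal (set_stabilizer H U) H,
    [/\ abelian_group (quotient sH nN),
        torsion_free (quotient sH nN)
      & forall x : quotient sH nN, x <> 1 -> ~ infinitely_divisible x].
Proof.
exists (set_stabilizer_normal sH coU tidyU).
set nN := set_stabilizer_normal _ _ _.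
have sM := @quotient_scaleM G H U sH coU nN.
have sX := @quotient_scaleX G H U sH coU tidyU nN.
have s1 := @quotient_scale_eq1 G H U sH coU nN.
split; first exact: hom_length_abelian sM sX s1.
  exact: hom_length_torsion_free sX s1.
move=> x; exact: (hom_length_not_infinitely_divisible sM sX s1).
Qed.
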